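(* For all integers $N\ge 1$, all $\Delta t>0$, and all integers $n\ne0$, the Fourier-mode vectors $\bm{\sigma}^n,\bm{f}^n\in\mathbb{C}^{N+1}$ of the forward Euler scheme for the Dirichlet problem on the unit circle (defined in the context) satisfy $$\|\bm{\sigma}^n\|\;\le\;\frac{1}{\frac12-\frac{1}{2|n|+1}}\,\|\bm{f}^n\|\;\le\;6\,\|\bm{f}^n\| .$$
   Context: For $n\in\mathbb{Z}$, the $n$th Fourier mode of the forward Euler scheme for the double-layer Volterra integral equation of the heat equation Dirichlet problem on the unit circle is the linear system $(-\tfrac12 I-V^n)\bm{\sigma}^n=\bm{f}^n$ for $\bm{\sigma}^n=\{\sigma_j^n\}_{j=0}^N$ with data $\bm{f}^n=\{f_j^n\}_{j=0}^N$ (with the initialization convention $f^n_0=\sigma^n_0=0$), where $I$ is the identity and $V^n\in\mathbb{R}^{(N+1)\times(N+1)}$ has entries $V^n_{jk}=v^n_{j-k}$ for $j>k$ and $0$ otherwise, with $$v^n_l=\int_0^{\Delta t}\gamma_n(l\Delta t-\tau)\,d\tau\ (l\ge1),\qquad \gamma_n(t)=\frac{1}{8\pi t^2}\int_0^{2\pi}(1-\cos s)\,e^{-\frac{1-\cos s}{2t}}\cos(ns)\,ds\quad(t>0).$$ $\|\cdot\|$ is the $\ell^2$-norm on $\mathbb{C}^{N+1}$. *)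

(* Defs.v *)
From mathcomp Require Export all_boot all_order all_algebra.
From mathcomp Require Export complex.
From mathcomp Require Export all_classical all_reals all_analysis.

Set Implicit Arguments.
Unset Strict Implicit.
Unset Printing Implicit Defensive.

Import Order.TTheory GRing.Theory Num.Theory.

Local Open Scope ring_scope.
Local Open Scope complex_scope.

(* [Rintegral] is the Lebesgue integral; it is needed for [vcoef] at l = 1,
   where the integrand is unbounded near tau = dt (gamma_n(t) is of order
   t^(-1/2) as t -> 0+), so that the integral is not a proper Riemann one. *)

Definition gamma (R : realType) (n : int) (t : R) : R :=
  1 / (8 * pi * t ^+ 2) *
  (\int[lebesgue_measure]_(s in `[0, 2 * pi])
     ((1 - cos s) * expR (- ((1 - cos s) / (2 * t))) * cos (n%:~R * s)))%R.

Definition vcoef (R : realType) (n : int) (dt : R) (l : nat) : R :=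
  (\int[lebesgue_measure]_(tau in `[0, dt]) gamma n (l%:R * dt - tau))%R.

Definition Vmx (R : realType) (n : int) (dt : R) (N : nat) : 'M[R]_N.+1 :=
  \matrix_(j, k) if (k < j)%N then vcoef n dt (j - k)%N else 0.

(* The norm that the library puts on 'cV is the sup norm. *)
Definition l2norm (R : realType) (m : nat) (x : 'cV[R[i]]_m) : R :=
  Num.sqrt (\sum_(i < m) Normc.normc (x i 0) ^+ 2).

(* Main.v *)
Require Import Defs.
From mathcomp Require Import zify ring lra measurable_realfun.

Set Implicit Arguments.
Unset Strict Implicit.
Unset Printing Implicit Defensive.

Import Order.TTheory GRing.Theory Num.Theory numFieldNormedType.Exports.

Local Open Scope ring_scope.
Local Open Scope classical_set_scope.
Local Open Scope complex_scope.

(** Let [k = |n|], [u = (1 + cos s) / 2], and let [b m] be the binomial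
    coefficient [C(2m, m+k)] over [4^m], which is the mean of [u^m cos (k s)]
    over the circle. With [x = 1/t], the primitive of [gamma_n] vanishing at [0]
    is [F t = e^(-x) / 2 * \sum_m x^m / m! * b m], and [gamma_n t] is
    [e^(-x) / (2 t^2) * \sum_m x^m / m! * (b m - b (m+1))].
    Since [0 <= b m <= 1 / (2k+1)], [F] takes values in [0, 1 / (2 (2k+1))].
    The differences [b m - b (m+1)] change sign once, so [gamma_n] is first
    nonnegative and then nonpositive. Hence so are the [v_l], which are
    increments of [F], and [\sum_l |v_l| <= 2 sup F <= 1 / (2k+1)]. The estimate
    is then Young's inequality for the convolution with [|v_l|]. *)

(** * Central binomial coefficients as natural numbers *)

Lemma leq_bin_far (N i j : nat) : (N <= 2 * i)%N -> (i <= j)%N -> ('C(N, j) <= 'C(N, i))%N.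
Proof.
move=> Ni /subnKC <-; elim: (j - i)%N => [|k IH]; first by rewrite addn0.
rewrite addnS (leq_trans _ IH) // -(leq_pmul2l (ltn0Sn (i + k))) mul_bin_left.
by rewrite leq_mul2r; apply/orP; right; lia.
Qed.

(** The [2n+1] entries of row [2m] with index from [m-n] to [m+n] are all at least the outermost
    one, and the whole row sums to [4^m]. *)
Lemma central_bin_bound (m n : nat) :
  ((2 * n + 1) * 'C(2 * m, m + n) <= 2 ^ (2 * m))%N.
Proof.
have [nm|mn] := leqP n m; last by rewrite bin_small ?muln0 //; lia.
have -> : (2 ^ (2 * m) = \sum_(i < (2 * m).+1) 'C(2 * m, i))%N.
  by rewrite (expnDn 1 1); apply: eq_bigr => i _; rewrite !exp1n !muln1.
rewrite -(big_mkord xpredT (fun i => 'C(2 * m, i))).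
have h1 : (m - n <= (2 * m).+1)%N by lia.
have h2 : (m - n <= (m + n).+1)%N by lia.
have h3 : ((m + n).+1 <= (2 * m).+1)%N by lia.
rewrite (big_cat_nat (leq0n _) h1) /= (big_cat_nat h2 h3) /=.
apply: leq_trans (leq_addl _ _); apply: leq_trans (leq_addr _ _).
have -> : ((2 * n + 1) * 'C(2 * m, m + n) =
   \sum_(m - n <= i < (m + n).+1) 'C(2 * m, m + n))%N.
  by rewrite sum_nat_const_nat; congr muln; lia.
rewrite !big_nat; apply: leq_sum => i /andP[i1 i2].
have [mi|im] := leqP m i; first by apply: leq_bin_far; lia.
have -> : ('C(2 * m, i) = 'C(2 * m, 2 * m - i))%N by rewrite bin_sub //; lia.
by apply: leq_bin_far; lia.
Qed.

(** Two absorption identities, the first lowering both indices and the second only the upper one,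
    give the ratio of consecutive coefficients in cross-multiplied form. *)
Lemma central_bin_ratio (m n : nat) : (n <= m.+1)%N ->
  ('C(2 * m.+1, m.+1 + n) * ((m.+1 + n) * (m.+1 - n)) =
   'C(2 * m, m + n) * ((2 * m).+2 * (2 * m).+1))%N.
Proof.
move=> nm; have e1 := mul_bin_diag (2 * m).+2 (m + n).
have e2 := mul_bin_down (2 * m).+1 (m + n).
rewrite /= in e1 e2.
have -> : (2 * m.+1 = (2 * m).+2)%N by lia.
have -> : (m.+1 - n = (2 * m).+1 - (m + n))%N by lia.
rewrite addSn mulnA [('C(_, _) * _)%N]mulnC -e1 -mulnA [('C(_, _) * _)%N]mulnC -e2; lia.
Qed.

(** * Normalized central binomial coefficients: recurrences, bound, monotonicity *)

Section CentralBinomial.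
Variable R : realType.

Definition cbin (m n : nat) : R := 'C(2 * m, m + n)%:R / 4 ^+ m.

Lemma cbin_ge0 m n : 0 <= cbin m n.
Proof. by rewrite divr_ge0 // exprn_ge0. Qed.

Lemma cbin0 n : cbin 0 n = (n == 0%N)%:R.
Proof. by rewrite /cbin muln0 add0n bin0n expr0 divr1. Qed.

(** This is the recurrence of [cbinSS] at index [0]: the symmetry of the row turns the neighbour at
    [-1] into the one at [1]. *)
Lemma cbinS0 m : cbin m.+1 0 = (cbin m 0 + cbin m 1) / 2.
Proof.
rewrite /cbin !addn0 addn1.
have -> : (2 * m.+1 = (2 * m).+2)%N by lia.
case: m => [|m]; first by rewrite !muln0 !bin0n bin1 /= expr0 expr1; field.
have : 'C(2 * m.+1, m) = 'C(2 * m.+1, m.+2).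
  by rewrite -bin_sub; [congr binomial|]; lia.
move: (2 * m.+1)%N => N e; rewrite !binS e.
have : (4 : R) ^+ m != 0 by rewrite expf_neq0.
by move=> h4; rewrite !natrD !exprS; field.
Qed.

Lemma cbinSS m n : cbin m.+1 n.+1 =
  (cbin m n + 2 * cbin m n.+1 + cbin m n.+2) / 4.
Proof.
rewrite /cbin !addSn !addnS.
have -> : (2 * m.+1 = (2 * m).+2)%N by lia.
move: (2 * m)%N => N; rewrite !binS.
have : (4 : R) ^+ m != 0 by rewrite expf_neq0.
by move=> h4; rewrite !natrD !exprS; field.
Qed.

Lemma cbin_le m n : cbin m n <= 1 / (2 * n%:R + 1).
Proof.
have p : 0 < (2 * n%:R + 1 : R) by rewrite ltr_wpDl // mulr_ge0.
rewrite ler_pdivlMr // /cbin mulrAC ler_pdivrMr ?exprn_gt0 // mul1r.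
have := central_bin_bound m n; rewrite -(ler_nat R) natrM natrX natrD natrM.
by rewrite exprM mulrC (_ : 2 ^+ 2 = 4 :> R) //; ring.
Qed.

(** The factors are [(m+1)^2 - n^2] and [(m+1)^2 - (m+1)/2], so comparing [m+1] with [2 n^2] decides
    whether the coefficient grows or decreases. *)
Let cbin_ratio m n : (n <= m.+1)%N ->
  cbin m.+1 n * ((m.+1%:R + n%:R) * (m.+1%:R - n%:R)) =
  cbin m n * ((m.+1%:R) ^+ 2 - m.+1%:R / 2).
Proof.
move=> nm; rewrite -natrB //; have := congr1 (fun k => k%:R : R) (central_bin_ratio nm).
rewrite !natrM natrD /cbin => e.
have : (4 : R) ^+ m != 0 by rewrite expf_neq0.
have e2 : (2 * m).+2%:R = 2 * m%:R + 2 :> R by rewrite -addn2 natrD natrM.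
have e1 : (2 * m).+1%:R = 2 * m%:R + 1 :> R by rewrite -addn1 natrD natrM.
move=> h4; rewrite mulrAC e exprS e1 e2 -[m.+1]addn1 natrD; by field.
Qed.

Lemma cbin_incr m n : (m.+1 <= 2 * n ^ 2)%N -> cbin m n <= cbin m.+1 n.
Proof.
move=> h; have [mn|nm] := ltnP m n.
  by rewrite {1}/cbin bin_small ?mul0r ?cbin_ge0 //; lia.
have p : 0 < ((m.+1%:R + n%:R) * (m.+1%:R - n%:R) : R).
  by rewrite mulr_gt0 ?subr_gt0 ?ltr_nat ?ltr_wpDr.
rewrite -(ler_pM2r p) cbin_ratio; last by lia.
rewrite ler_wpM2l ?cbin_ge0 //.
move: h; rewrite -(ler_nat R) natrM natrX => h; nra.
Qed.

Lemma cbin_decr m n : (2 * n ^ 2 <= m.+1)%N -> cbin m.+1 n <= cbin m n.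
Proof.
move=> h; have nm : (n < m.+1)%N.
  by move: h; rewrite expnS expn1; nia.
have p : 0 < ((m.+1%:R + n%:R) * (m.+1%:R - n%:R) : R).
  by rewrite mulr_gt0 ?subr_gt0 ?ltr_nat ?ltr_wpDr.
rewrite -(ler_pM2r p) cbin_ratio; last by lia.
rewrite ler_wpM2l ?cbin_ge0 //.
move: h; rewrite -(ler_nat R) natrM natrX => h; nra.
Qed.

End CentralBinomial.

(** * Integrals over one period and the moments of [half1cos] *)

Section CircleIntegral.
Variable R : realType.
Implicit Types (f g : R -> R) (a x s : R).
Local Notation mu := (@lebesgue_measure R).

Definition circ f : R := \int[mu]_(s in `[0, 2 * pi]) f s.

(** Since [(1 - cos s) / (2t) = 1/t - half1cos s / t], the exponential in the kernel is [e^(-1/t)]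
    times a power series in [half1cos s / t] with positive coefficients. *)
Definition half1cos s : R := (1 + cos s) / 2.

Lemma twopi_gt0 : 0 < 2 * pi :> R.
Proof. by rewrite mulr_gt0 ?pi_gt0. Qed.

Lemma continuous_cosM a : continuous (fun s : R => cos (a * s)).
Proof.
move=> s; apply: continuous_comp; last exact: continuous_cos.
exact: mulrl_continuous.
Qed.

Lemma continuous_half1cos : continuous half1cos.
Proof.
by move=> s; apply: cvgMl; apply: cvgD; [exact: cvg_cst|exact: continuous_cos].
Qed.

Lemma half1cos_ge0 s : 0 <= half1cos s.
Proof. by rewrite divr_ge0 // addrC -lerBlDr sub0r cos_geN1. Qed.

Lemma half1cos_le1 s : half1cos s <= 1.
Proof. by rewrite ler_pdivrMr // mul1r lerD2l cos_le1. Qed.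

Lemma continuous_integrable_itv f (b c : R) : continuous f ->
  mu.-integrable `[b, c] (EFin \o f).
Proof.
move=> cf; apply: continuous_compact_integrable; first exact: segment_compact.
exact: continuous_subspaceT.
Qed.

Lemma circD f g : continuous f -> continuous g ->
  circ (fun s => f s + g s) = circ f + circ g.
Proof.
by move=> cf cg; rewrite /circ RintegralD //; exact: continuous_integrable_itv.
Qed.

Lemma circZ a f : continuous f -> circ (fun s => a * f s) = a * circ f.
Proof.
by move=> cf; rewrite /circ RintegralZl //; exact: continuous_integrable_itv.
Qed.

Lemma le_circ f g : continuous f -> continuous g ->
  (forall s, f s <= g s) -> circ f <= circ g.
Proof.
move=> cf cg fg; apply: le_Rintegral => //; exact: continuous_integrable_itv.
Qed.

Lemma circ_cst a : circ (fun=> a) = 2 * pi * a.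
Proof.
rewrite /circ Rintegral_cst //= lebesgue_measure_itv /= lte_fin twopi_gt0.
by rewrite -EFinB /= subr0 mulrC.
Qed.

Lemma circ_norm_le a f : continuous f -> (forall s, `|f s| <= a) ->
  `|circ f| <= 2 * pi * a.
Proof.
move=> cf fa; rewrite ler_norml -mulrN -!circ_cst; apply/andP; split;
  by apply: le_circ => //; try exact: cst_continuous;
     move=> s; have := fa s; rewrite ler_norml => /andP[].
Qed.

Lemma sin_natpi (n : nat) : sin (n%:R * (2 * pi)) = 0 :> R.
Proof.
have -> : n%:R * (2 * pi) = 0 + (pi *+ 2) *+ n :> R.
  by rewrite add0r -[in RHS]mulr_natl -[pi *+ 2]mulr_natl.
by rewrite periodicn ?sin0 //; exact: sinD2pi.
Qed.

Lemma circ_cos (n : nat) : circ (fun s => cos (n%:R * s)) = 2 * pi * (n == 0)%:R.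
Proof.
case: n => [|n].
  by rewrite -circ_cst; congr circ; apply/funext => s; rewrite mul0r cos0.
have n0 : n.+1%:R != 0 :> R by rewrite pnatr_eq0.
(* The primitive [sin (n s) / n] vanishes at both endpoints of the period. *)
have dF (x : R) : is_derive x 1 (fun s => n.+1%:R^-1 * sin (n.+1%:R * s)) (cos (n.+1%:R * x)).
  have h : is_derive x 1 (fun s : R => n.+1%:R * s) n.+1%:R.
    have := @is_deriveZ _ _ _ (id : R -> R) n.+1%:R x 1 1 _.
    rewrite /GRing.scale /= mulr1; apply; exact: is_derive_id.
  have h2 := @is_derive1_comp _ sin (fun s => n.+1%:R * s) x _ _ (is_derive_sin _) h.
  have := @is_deriveZ _ _ _ _ n.+1%:R^-1 x 1 _ h2.
  rewrite /GRing.scale /=.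
  have -> : n.+1%:R^-1 * (cos (n.+1%:R * x) * n.+1%:R) = cos (n.+1%:R * x).
    by rewrite mulrCA mulVf ?mulr1.
  exact.
rewrite /= mulr0 /circ /Rintegral.
rewrite (@continuous_FTC2 _ _ (fun s => n.+1%:R^-1 * sin (n.+1%:R * s))) //.
- by rewrite /= sin_natpi !mulr0 sin0 mulr0 subrr.
- exact: twopi_gt0.
- exact/continuous_subspaceT/continuous_cosM.
- have cF : continuous (fun s => n.+1%:R^-1 * sin (n.+1%:R * s) : R).
    move=> s; apply: differentiable_continuous; apply/derivable1_diffP.
    by have [] := dF s.
  split => [x _||]; first by have [] := dF x.
  + exact/cvg_at_right_filter/cF.
  + exact/cvg_at_left_filter/cF.
- by move=> x _; rewrite derive1E; have [_ ->] := dF x.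
Qed.

Lemma continuous_half1cosXcos (m n : nat) : continuous (fun s => half1cos s ^+ m * cos (n%:R * s)).
Proof.
move=> s; apply: cvgM; last exact: continuous_cosM.
apply: (continuous_comp (f := half1cos) (g := fun y => y ^+ m)); first exact: continuous_half1cos.
exact: exprn_continuous.
Qed.

(* [half1cos * cos (n s)] is a combination of [cos ((n-1) s)], [cos (n s)] and
   [cos ((n+1) s)], and [cbin] obeys the same three-term recurrence. *)
Lemma circ_half1cosXcos (m n : nat) :
  circ (fun s => half1cos s ^+ m * cos (n%:R * s)) = 2 * pi * cbin R m n.
Proof.
elim: m n => [|m IH] n.
  rewrite cbin0 -circ_cos; congr circ; apply/funext => s.
  by rewrite expr0 mul1r.
have c1 a k : continuous (fun s => a * (half1cos s ^+ m * cos (k%:R * s))).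
  by move=> s; apply: cvgMr; exact: continuous_half1cosXcos.
case: n => [|n].
  rewrite cbinS0 (_ : (fun s => _) = (fun s =>
    1/2 * (half1cos s ^+ m * cos (0%:R * s)) + 1/2 * (half1cos s ^+ m * cos (1%:R * s)))).
    rewrite circD // !circZ; [|exact: continuous_half1cosXcos..].
    by rewrite !IH; move: (pi : R) => p; field.
  apply/funext => s; rewrite !mul0r cos0 (mul1r s) exprS /half1cos; move: (_ ^+ m) => U.
  by field.
rewrite cbinSS (_ : (fun s => _) = (fun s =>
    1/4 * (half1cos s ^+ m * cos (n%:R * s)) + (1/2 * (half1cos s ^+ m * cos (n.+1%:R * s))
    + 1/4 * (half1cos s ^+ m * cos (n.+2%:R * s))))).
  rewrite circD //; last by move=> s; apply: cvgD; exact: c1.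
  rewrite circD // !circZ; [|exact: continuous_half1cosXcos..].
  by rewrite !IH; move: (pi : R) => p; field.
apply/funext => s; rewrite exprS.
have -> : n%:R * s = n.+1%:R * s - s by rewrite -[n.+1]addn1 natrD; ring.
have -> : n.+2%:R * s = n.+1%:R * s + s by rewrite -[n.+2]addn1 natrD; ring.
rewrite !cosD cosN sinN /half1cos; move: (_ ^+ m) => U; by field.
Qed.

End CircleIntegral.

(** * Termwise integration of the exponential series *)

Section ExponentialSeries.
Variable R : realType.
Implicit Types (g : R -> R) (a x y s : R).

Lemma exp_series_cvg x : series (exp_coeff x) @ \oo --> expR x.
Proof. exact: is_cvg_series_exp_coeff. Qed.

Lemma exp_tail_ge0 x k : 0 <= x -> 0 <= expR x - series (exp_coeff x) k.
Proof.
move=> x0; rewrite subr_ge0 -(cvg_lim _ (@exp_series_cvg x)) //.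
apply: nondecreasing_cvgn_le; last exact: is_cvg_series_exp_coeff.
apply/nondecreasing_seqP => m; rewrite /series /= big_nat_recr //= lerDl.
by rewrite /exp_coeff /= divr_ge0 // exprn_ge0.
Qed.

(** The tail is a series of monomials with positive coefficients. Its monotonicity bounds the tail
    at [x * half1cos s] by the tail at [x], uniformly in [s]. *)
Lemma le_exp_tail x y k : 0 <= x -> x <= y ->
  expR x - series (exp_coeff x) k <= expR y - series (exp_coeff y) k.
Proof.
move=> x0 xy; suff : series (exp_coeff y) k - series (exp_coeff x) k
    <= expR y - expR x by lra.
have c : (fun j => series (exp_coeff y) j - series (exp_coeff x) j) @ \oo
    --> expR y - expR x by apply: cvgB; exact: exp_series_cvg.
rewrite -(cvg_lim _ c) //.
apply: (nondecreasing_cvgn_le (u_ := fun j => series (exp_coeff y) j - series (exp_coeff x) j));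
  last by apply/cvg_ex; exists (expR y - expR x).
apply/nondecreasing_seqP => m; rewrite /series /= !big_nat_recr //=.
suff : exp_coeff x m <= exp_coeff y m by lra.
by rewrite /exp_coeff /= ler_wpM2r ?invr_ge0 // lerXn2r // nnegrE (le_trans x0).
Qed.

Lemma continuous_half1cosXM g m : continuous g -> continuous (fun s => half1cos s ^+ m * g s).
Proof.
move=> cg s; apply: cvgM; last exact: cg.
apply: (continuous_comp (f := @half1cos R) (g := fun y => y ^+ m)); first exact: continuous_half1cos.
exact: exprn_continuous.
Qed.

Lemma continuous_exp_half1cosM g x : continuous g ->
  continuous (fun s => expR (x * half1cos s) * g s).
Proof.
move=> cg s; apply: cvgM; last exact: cg.
apply: (continuous_comp (f := fun s => x * half1cos s) (g := @expR R)).
  by apply: cvgMr; exact: continuous_half1cos.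
exact: continuous_expR.
Qed.

(** Continuity is proved in the same induction because additivity of [circ] asks for it at each
    step. *)
Lemma circ_exp_partial g x k : continuous g ->
  continuous (fun s => series (exp_coeff (x * half1cos s)) k * g s) /\
  circ (fun s => series (exp_coeff (x * half1cos s)) k * g s) =
  \sum_(0 <= m < k) x ^+ m / m`!%:R * circ (fun s => half1cos s ^+ m * g s).
Proof.
move=> cg; elim: k => [|k [cIH IH]].
  rewrite big_nil (_ : (fun s => _) = (fun=> 0)); last first.
    by apply/funext => s; rewrite /series /= big_nil mul0r.
  by split; [exact: cst_continuous|rewrite circ_cst mulr0].
rewrite big_nat_recr //= -IH (_ : (fun s => _) = (fun s =>
    series (exp_coeff (x * half1cos s)) k * g s + x ^+ k / k`!%:R * (half1cos s ^+ k * g s))).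
  have c : continuous (fun s => x ^+ k / k`!%:R * (half1cos s ^+ k * g s)).
    by move=> s; apply: cvgMr; exact: continuous_half1cosXM.
  split; first by move=> s; apply: cvgD; [exact: cIH|exact: c].
  by rewrite circD // circZ //; exact: continuous_half1cosXM.
apply/funext => s; rewrite /series /= big_nat_recr //= mulrDl; congr (_ + _).
by rewrite /exp_coeff /= exprMn; ring.
Qed.

(** The error after [k] terms is at most [2 pi a] times the tail of the series of [expR x], by
    [0 <= half1cos <= 1] and [le_exp_tail]. *)
Lemma circ_exp_cvg g x a : 0 <= x -> continuous g -> (forall s, `|g s| <= a) ->
  (fun k => \sum_(0 <= m < k) x ^+ m / m`!%:R * circ (fun s => half1cos s ^+ m * g s))
    @ \oo --> circ (fun s => expR (x * half1cos s) * g s).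
Proof.
move=> x0 cg ga.
have t0 : (fun k => 2 * pi * ((expR x - series (exp_coeff x) k) * a)) @ \oo --> (0 : R).
  rewrite -[X in _ --> X](mulr0 (2 * pi)) -(mul0r a) -(subrr (expR x)).
  apply: cvgMr; apply: cvgMl; apply: cvgB; [exact: cvg_cst|exact: exp_series_cvg].
apply/cvgrPdist_le => e e0.
move/cvgrPdist_le : t0 => /(_ e e0); apply: filterS => k.
rewrite sub0r normrN => /(le_trans _); apply; apply: le_trans (ler_norm _).
have [ck <-] := circ_exp_partial x k cg.
rewrite -[- circ _]mulN1r -circZ //.
have ck' : continuous (fun s => -1 * (series (exp_coeff (x * half1cos s)) k * g s)).
  by move=> s; apply: cvgMr; exact: ck.
have ce := continuous_exp_half1cosM (x := x) cg.
rewrite -circD //; apply: circ_norm_le => [s|s].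
  by apply: cvgD; [exact: ce|exact: ck'].
rewrite mulN1r -mulrBl normrM ler_pM //.
have xu : 0 <= x * half1cos s by rewrite mulr_ge0 ?half1cos_ge0.
rewrite ger0_norm ?exp_tail_ge0 // le_exp_tail //.
by rewrite ler_piMr ?half1cos_le1.
Qed.

End ExponentialSeries.

(** * The primitive of the kernel, its bounds, and the sign of the kernel integral *)

Section Potential.
Variables (R : realType) (n : nat).
Implicit Types (t x y s : R).

(** This is [2 pi e^(x/2) I_n(x/2)], with [I_n] the modified Bessel function. *)
Definition expcos x : R := circ (fun s => expR (x * half1cos s) * cos (n%:R * s)).

Definition expversin x : R :=
  circ (fun s => expR (x * half1cos s) * ((1 - cos s) * cos (n%:R * s))).

(** The function [F] for [t > 0]: the [t]-derivative of its exponential brings down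
    [(1 - cos s) / (2 t^2)], which turns [1 / (4 pi)] into the prefactor of [gamma]. *)
Definition pot t : R := 1 / (4 * pi) *
  circ (fun s => expR (- ((1 - cos s) / (2 * t))) * cos (n%:R * s)).

Lemma continuous_1mcoscos : continuous (fun s : R => (1 - cos s) * cos (n%:R * s)).
Proof.
move=> s; apply: cvgM; last exact: continuous_cosM.
by apply: cvgB; [exact: cvg_cst|exact: continuous_cos].
Qed.

Lemma norm_cos_le1 s : `|cos s| <= 1.
Proof. by rewrite ler_norml cos_geN1 cos_le1. Qed.

Lemma expcos_cvg x : 0 <= x ->
  (fun k => \sum_(0 <= m < k) x ^+ m / m`!%:R * (2 * pi * cbin R m n)) @ \oo --> expcos x.
Proof.
move=> x0.
rewrite (_ : (fun k => \sum_(0 <= m < k) _) = (fun k => \sum_(0 <= m < k)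
    x ^+ m / m`!%:R * circ (fun s => half1cos s ^+ m * cos (n%:R * s)))).
  exact: (circ_exp_cvg x0 (@continuous_cosM R n%:R) (fun s => norm_cos_le1 (n%:R * s))).
by apply/funext => k; apply: eq_bigr => m _; rewrite circ_half1cosXcos.
Qed.

Lemma expversin_cvg x : 0 <= x ->
  (fun k => \sum_(0 <= m < k) x ^+ m / m`!%:R *
     (4 * pi * (cbin R m n - cbin R m.+1 n))) @ \oo --> expversin x.
Proof.
move=> x0.
have b s : `|(1 - cos s) * cos (n%:R * s)| <= 2.
  rewrite normrM -[2]mulr1 ler_pM ?norm_cos_le1 //.
  by rewrite (le_trans (ler_normB _ _)) // normr1 -lerBrDl (le_trans (norm_cos_le1 _)) //; lra.
rewrite (_ : (fun k => \sum_(0 <= m < k) _) = (fun k => \sum_(0 <= m < k)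
    x ^+ m / m`!%:R * circ (fun s => half1cos s ^+ m * ((1 - cos s) * cos (n%:R * s))))).
  exact: (circ_exp_cvg x0 continuous_1mcoscos b).
apply/funext => k; apply: eq_bigr => m _; congr (_ * _).
(* The identity [1 - cos s = 2 (1 - half1cos s)] makes the coefficient a difference of consecutive
   moments. *)
have -> : (fun s : R => half1cos s ^+ m * ((1 - cos s) * cos (n%:R * s))) =
  (fun s => 2 * (half1cos s ^+ m * cos (n%:R * s)) + -2 * (half1cos s ^+ m.+1 * cos (n%:R * s))).
  by apply/funext => s; rewrite exprS /half1cos; field.
rewrite circD; try by move=> s; apply: cvgMr; exact: continuous_half1cosXcos.
rewrite !circZ; try exact: continuous_half1cosXcos.
by rewrite !circ_half1cosXcos; move: (pi : R) => p; ring.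
Qed.

Lemma expcos_ge0 x : 0 <= x -> 0 <= expcos x.
Proof.
move=> x0; rewrite -(cvg_lim _ (expcos_cvg x0)) //.
apply: limr_ge; first by apply/cvg_ex; exists (expcos x); exact: expcos_cvg.
apply: nearW => k; apply: sumr_ge0 => m _.
by rewrite mulr_ge0 ?divr_ge0 ?exprn_ge0 // mulr_ge0 ?cbin_ge0 ?(ltW (twopi_gt0 R)).
Qed.

(** By [cbin_le] the series is dominated term by term by [2 pi / (2n+1)] times the exponential
    series. *)
Lemma expcos_le x : 0 <= x -> expcos x <= 2 * pi / (2 * n%:R + 1) * expR x.
Proof.
move=> x0; rewrite -(cvg_lim _ (expcos_cvg x0)) //.
apply: limr_le; first by apply/cvg_ex; exists (expcos x); exact: expcos_cvg.
apply: nearW => k.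
apply: (@le_trans _ _ (2 * pi / (2 * n%:R + 1) * series (exp_coeff x) k)).
  rewrite /series /= mulr_sumr; apply: ler_sum => m _.
  rewrite mulrC /exp_coeff /= ler_wpM2r ?divr_ge0 ?exprn_ge0 //.
  rewrite ler_wpM2l ?(ltW (twopi_gt0 R)) //.
  by have := cbin_le R m n; rewrite mul1r.
rewrite ler_wpM2l //; last by rewrite -subr_ge0 exp_tail_ge0.
by rewrite divr_ge0 ?(ltW (twopi_gt0 R)) // addr_ge0 ?mulr_ge0.
Qed.

Lemma expR_half1cosE x s : x != 0 ->
  expR (- ((1 - cos s) / (2 * x))) = expR (- x^-1) * expR (x^-1 * half1cos s).
Proof. by move=> x0; rewrite -expRD; congr expR; rewrite /half1cos; field. Qed.

Lemma potE t : 0 < t -> pot t = 1 / (4 * pi) * (expR (- t^-1) * expcos t^-1).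
Proof.
move=> t0; rewrite /pot /expcos -circZ; last exact/(@continuous_exp_half1cosM R)/continuous_cosM.
congr (_ * circ _); apply/funext => s; rewrite expR_half1cosE ?gt_eqF //; ring.
Qed.

Lemma pot_ge0 t : 0 < t -> 0 <= pot t.
Proof.
move=> t0; rewrite potE // mulr_ge0 ?divr_ge0 ?mulr_ge0 ?pi_ge0 ?expR_ge0 //.
by rewrite expcos_ge0 // invr_ge0 ltW.
Qed.

Lemma pot_le t : 0 < t -> pot t <= 1 / (2 * (2 * n%:R + 1)).
Proof.
move=> t0; rewrite potE //; have p0 : 0 < pi :> R := pi_gt0 R.
have x0 : 0 <= t^-1 by rewrite invr_ge0 ltW.
have n0 : 0 < 2 * n%:R + 1 :> R by rewrite ltr_wpDl ?mulr_ge0.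
have := expcos_le x0; rewrite expRN.
move: (expR_gt0 t^-1); move: (expR _) => e e0; move: (expcos _) => c.
move: (pi : R) p0 => p p0.
have q0 : 0 < 4 * p by rewrite mulr_gt0.
(* The factor [e^(-1/t)] cancels the exponential, and [1 / (4 pi)] times [2 pi / (2n+1)] is the
   stated bound. *)
move=> h; rewrite mul1r ler_pdivrMl // ler_pdivrMl //; apply: le_trans h _.
by rewrite le_eqVlt; apply/orP; left; apply/eqP; field; rewrite !gt_eqF.
Qed.

(* The first [2 n^2] coefficients of the power series are nonpositive and the
   remaining ones nonnegative. *)
Lemma expversin_ge0 x y : 0 < x -> x <= y -> 0 <= expversin x -> 0 <= expversin y.
Proof.
move=> x0 xy Jx; have y0 := lt_le_trans x0 xy.
(* [M] is the index where the coefficients change sign. Then [(y/x)^m - (y/x)^M] has the sign of the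
   [m]-th coefficient, so [expversin y] exceeds [(y/x)^M * expversin x] term by term. *)
pose M := (2 * n ^ 2)%N; have q0 : 0 <= (y / x) ^+ M.
  by rewrite exprn_ge0 // divr_ge0 ?ltW.
apply: (@le_trans _ _ ((y / x) ^+ M * expversin x)); first exact: mulr_ge0.
have cx := expversin_cvg (ltW x0); have cy := expversin_cvg (ltW y0).
have cqx : (fun k => (y / x) ^+ M * \sum_(0 <= m < k) x ^+ m / m`!%:R *
    (4 * pi * (cbin R m n - cbin R m.+1 n))) @ \oo --> (y / x) ^+ M * expversin x.
  exact: cvgMr.
rewrite -(cvg_lim _ cqx) // -(cvg_lim _ cy) //; apply: ler_lim.
- by apply/cvg_ex; exists ((y / x) ^+ M * expversin x).
- by apply/cvg_ex; exists (expversin y).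
apply: nearW => k; rewrite mulr_sumr; apply: ler_sum => m _.
have yx : (y ^+ m = (y / x) ^+ m * x ^+ m) by rewrite -exprMn divfK ?gt_eqF.
rewrite yx; move: (@cbin_incr R m n) (@cbin_decr R m n) => i d.
have yx1 : 1 <= y / x by rewrite ler_pdivlMr // mul1r.
have p0 := pi_gt0 R.
have X : 0 <= x ^+ m / m`!%:R by rewrite divr_ge0 ?exprn_ge0 // ltW.
rewrite -subr_ge0 (_ : _ - _ = ((y / x) ^+ m - (y / x) ^+ M) *
  (x ^+ m / m`!%:R * (4 * pi) * (cbin R m n - cbin R m.+1 n))); last by ring.
have Xp : 0 <= x ^+ m / m`!%:R * (4 * pi) by rewrite mulr_ge0 // mulr_ge0 // ltW.
have [mM|Mm] := ltnP m M.
- apply: mulr_le0; first by rewrite subr_le0 ler_weXn2l // ltnW.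
  by rewrite mulr_ge0_le0 // subr_le0 i.
- apply: mulr_ge0; first by rewrite subr_ge0 ler_weXn2l.
  by rewrite mulr_ge0 // subr_ge0 d // (leq_trans Mm).
Qed.

End Potential.

(** * The single change of sign of [gamma] *)

Lemma cos_intM (R : realType) (n : int) (s : R) : cos (n%:~R * s) = cos (`|n|%N%:R * s).
Proof.
case: n => n; first by rewrite -pmulrn.
by rewrite NegzE abszN mulrNz mulNr cosN.
Qed.

Lemma gammaE (R : realType) (n : int) (t : R) : 0 < t ->
  gamma n t = 1 / (8 * pi * t ^+ 2) * (expR (- t^-1) * expversin `|n|%N t^-1).
Proof.
move=> t0; rewrite /gamma /expversin -circZ; last exact/(@continuous_exp_half1cosM R)/continuous_1mcoscos.
congr (_ * circ _); apply/funext => s; rewrite cos_intM expR_half1cosE ?gt_eqF //; ring.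
Qed.

(** Contraposition: a positive value at [t'] makes [expversin] nonnegative at [1/t'], hence at the
    larger point [1/t]. *)
Lemma gamma_le0_after (R : realType) (n : int) (t t' : R) :
  0 < t -> t <= t' -> gamma n t < 0 -> gamma n t' <= 0.
Proof.
move=> t0 tt'; have t'0 := lt_le_trans t0 tt'; have p0 := pi_gt0 R.
rewrite !gammaE // => h; rewrite leNgt; apply/negP => h'; move: h.
apply/negP; rewrite -leNgt mulr_ge0 //.
  by rewrite divr_ge0 // mulr_ge0 ?exprn_ge0 ?mulr_ge0 // ltW.
rewrite mulr_ge0 ?expR_ge0 //; apply: (@expversin_ge0 _ _ t'^-1).
- by rewrite invr_gt0.
- by rewrite lef_pV2.
- have c : 0 < 1 / (8 * pi * t' ^+ 2) by rewrite divr_gt0 // !mulr_gt0 // exprn_gt0.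
  by move: h'; rewrite (pmulr_rgt0 _ c) (pmulr_rgt0 _ (expR_gt0 _)); exact: ltW.
Qed.

(** * Stability of lower triangular Toeplitz systems, applied to the scheme *)

Section Stability.
Variable R : realType.

(* The partial sums rise to their maximum and then fall, so the sum of absolute
   values is twice the maximum minus the last partial sum. *)
Lemma sum_norm_le_unimodal (v : nat -> R) (B : R) (N : nat) :
  (forall L, 0 <= \sum_(0 <= l < L) v l <= B) ->
  (forall l l', (l < l')%N -> v l < 0 -> v l' <= 0) ->
  \sum_(0 <= l < N) `|v l| <= 2 * B.
Proof.
move=> vB vs; suff : \sum_(0 <= l < N) `|v l| <= 2 * B - \sum_(0 <= l < N) v l.
  by move/le_trans; apply; have /andP[] := vB N; lra.
elim: N => [|N IH].
  by rewrite !big_nil; have /andP[] := vB 0; rewrite !big_nil; lra.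
have [vN|vN] := lerP (v N) 0.
  by rewrite !big_nat_recr //= ler0_norm //; lra.
(* A positive last term excludes earlier negative ones, so the sum of absolute values is the partial
   sum itself, which is at most [B]. *)
rewrite (_ : \sum_(0 <= l < N.+1) `|v l| = \sum_(0 <= l < N.+1) v l).
  by have /andP[] := vB N.+1; lra.
rewrite !big_nat; apply: eq_bigr => l /andP[_ lN].
rewrite ger0_norm //; move: lN; rewrite ltnS leq_eqVlt => /predU1P[->|lN].
  exact: ltW.
by rewrite leNgt; apply/negP => /(vs _ _ lN); rewrite leNgt vN.
Qed.

Section Toeplitz.
Variables (N : nat) (a : nat -> R) (A : R).
Hypothesis a0 : forall l, 0 <= a l.
Hypothesis aA : \sum_(0 <= l < N) a l.+1 <= A.

Let sum_le M : (M <= N)%N -> \sum_(0 <= l < M) a l.+1 <= A.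
Proof.
move=> MN; apply: le_trans aA; rewrite [leRHS](big_cat_nat (leq0n _) MN) /= lerDl.
by apply: sumr_ge0.
Qed.

(** Row [j] carries [a 1, ..., a j] in reverse order. *)
Lemma toeplitz_row_sum_le (j : 'I_N.+1) : \sum_(k < N.+1 | (k < j)%N) a (j - k)%N <= A.
Proof.
have jN : (j <= N.+1)%N by rewrite ltnW.
rewrite -(big_mkord (fun k => (k < j)%N) (fun k => a (j - k)%N)).
rewrite (big_cat_nat (leq0n j) jN) /= [X in _ + X]big_nat_cond [X in _ + X]big_pred0 ?addr0; last first.
  by move=> k; apply/negbTE/negP => /andP[/andP[]]; lia.
rewrite big_nat_rev /= add0n; apply: le_trans (sum_le (M := j) _); last by rewrite -ltnS.
rewrite big_nat_cond [leRHS]big_nat_cond.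
rewrite le_eqVlt; apply/orP; left; apply/eqP; apply: eq_big => [k|k]; first by lia.
by move=> /andP[/andP[_ kj] _]; congr a; lia.
Qed.

(** Column [k] carries [a 1, ..., a (N - k)]. *)
Lemma toeplitz_col_sum_le (k : 'I_N.+1) : \sum_(j < N.+1 | (k < j)%N) a (j - k)%N <= A.
Proof.
have kN : (k.+1 <= N.+1)%N by [].
rewrite -(big_mkord (fun j => (k < j)%N) (fun j => a (j - k)%N)).
rewrite (big_cat_nat (leq0n k.+1) kN) /= [X in X + _]big_nat_cond [X in X + _]big_pred0 ?add0r; last first.
  by move=> j; apply/negbTE/negP => /andP[/andP[]]; lia.
rewrite -[k.+1]add0n big_addn; apply: le_trans (sum_le (M := (N.+1 - k.+1)%N) _); last by lia.
rewrite big_nat_cond [leRHS]big_nat_cond.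
rewrite le_eqVlt; apply/orP; left; apply/eqP; apply: eq_big => [j|j]; first by lia.
by move=> /andP[/andP[_ kj] _]; congr a; lia.
Qed.

(** Schur test: [y_j y_k <= (y_j^2 + y_k^2) / 2] splits the form into row sums and column sums, each
    contributing half of [A]. *)
Lemma toeplitz_form_le (y : 'I_N.+1 -> R) :
  \sum_(j < N.+1) y j * (\sum_(k < N.+1 | (k < j)%N) a (j - k)%N * y k) <= A * \sum_(j < N.+1) y j ^+ 2.
Proof.
have h : \sum_(j < N.+1) y j * (\sum_(k < N.+1 | (k < j)%N) a (j - k)%N * y k) <=
   \sum_(j < N.+1) (y j ^+ 2 / 2 * \sum_(k < N.+1 | (k < j)%N) a (j - k)%N) +
   \sum_(j < N.+1) \sum_(k < N.+1 | (k < j)%N) a (j - k)%N * (y k ^+ 2 / 2).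
  rewrite -big_split /=; apply: ler_sum => j _.
  rewrite !mulr_sumr -big_split /=; apply: ler_sum => k _.
  by have := a0 (j - k)%N; have := sqr_ge0 (y j - y k); nra.
apply: le_trans h _.
rewrite (exchange_big_dep xpredT) //= -big_split /= mulr_sumr; apply: ler_sum => j _.
rewrite -mulr_suml [X in _ + X]mulrC -mulrDr.
have := toeplitz_row_sum_le j; have := toeplitz_col_sum_le j.
by have := sqr_ge0 (y j); nra.
Qed.

(* Summing [y j] times the inequalities and using
   [2 c (y j) (z j) <= c^2 (y j)^2 + (z j)^2] with [c = 1/2 - A]. *)
Lemma toeplitz_stable (y z : 'I_N.+1 -> R) :
  A < 1 / 2 -> (forall j, 0 <= y j) ->
  (forall j, y j / 2 <= z j + \sum_(k < N.+1 | (k < j)%N) a (j - k)%N * y k) ->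
  Num.sqrt (\sum_(j < N.+1) y j ^+ 2) <= 1 / (1 / 2 - A) * Num.sqrt (\sum_(j < N.+1) z j ^+ 2).
Proof.
move=> A2 y0 yz; pose c := 1 / 2 - A; have c0 : 0 < c by rewrite subr_gt0.
have h : \sum_(j < N.+1) y j ^+ 2 / 2 <= \sum_(j < N.+1) y j * z j + A * \sum_(j < N.+1) y j ^+ 2.
  apply: le_trans (lerD (lexx _) (toeplitz_form_le y)).
  rewrite -big_split /=; apply: ler_sum => j _.
  by have := yz j; have := y0 j; set S := \sum_(_ < _ | _) _; nra.
have h2 : \sum_(j < N.+1) (2 * c * (y j * z j)) <= \sum_(j < N.+1) (c ^+ 2 * y j ^+ 2 + z j ^+ 2).
  by apply: ler_sum => j _; have := sqr_ge0 (c * y j - z j); nra.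
move: h h2; rewrite -mulr_suml -mulr_sumr big_split /= -mulr_sumr.
set Y := \sum_(j < N.+1) y j ^+ 2; set Z := \sum_(j < N.+1) z j ^+ 2; set P := \sum_(j < N.+1) _ => h h2.
have Y0 : 0 <= Y by apply: sumr_ge0 => j _; exact: sqr_ge0.
have k : c ^+ 2 * Y <= Z.
  have : c * Y <= P by rewrite /c; lra.
  by move/(ler_wpM2l (ltW c0)); nra.
rewrite mul1r ler_pdivlMl // -[X in X * _](ger0_norm (ltW c0)) -sqrtr_sqr.
by rewrite -sqrtrM ?sqr_ge0 // ler_wsqrtr.
Qed.

End Toeplitz.

End Stability.

(** Row [j] of the system reads [sigma_j / 2 = - (f_j + \sum_(k < j) v_(j-k) sigma_k)]. Taking
    moduli gives the real inequalities of [toeplitz_stable]. *)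
Lemma euler_stable (R : realType) (N : nat) (dt : R) (n : int) (A : R)
    (sigma f : 'cV[R[i]]_N.+1) :
  map_mx (real_complex R) (- (1 / 2)%:M - Vmx n dt N) *m sigma = f ->
  \sum_(0 <= l < N) `|vcoef n dt l.+1| <= A -> A < 1 / 2 ->
  l2norm sigma <= 1 / (1 / 2 - A) * l2norm f.
Proof.
move=> eqf vA A2; rewrite /l2norm.
apply: (@toeplitz_stable R N (fun l => `|vcoef n dt l|) A _ vA
   (fun j => Normc.normc (sigma j 0)) (fun j => Normc.normc (f j 0))) => // j.
  by case: (sigma j 0) => x y; rewrite /= sqrtr_ge0.
have e : sigma j 0 * (1 / 2)%:C =
    - (f j 0 + \sum_(k < N.+1 | (k < j)%N) (vcoef n dt (j - k)%N)%:C * sigma k 0).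
  rewrite -eqf mxE.
  under eq_bigr => k _ do rewrite !mxE rmorphB /= rmorphN /= mulrBl mulNr.
  rewrite sumrB sumrN (bigD1 j) //= eqxx mulr1n big1 ?addr0; last first.
    by move=> k /negbTE kj; rewrite eq_sym kj mulr0n mul0r.
  rewrite (bigID (fun k : 'I_N.+1 => (k < j)%N)) /= [X in _ - (_ + X)]big1 ?addr0; last first.
    by move=> k /negbTE ->; rewrite mul0r.
  rewrite [X in _ - X](eq_bigr (fun k : 'I_N.+1 => (vcoef n dt (j - k)%N)%:C * sigma k 0)).
    by rewrite addrNK opprK mulrC.
  by move=> k ->.
have nr (x : R) : Normc.normc x%:C = `|x| by rewrite /= expr0n addr0 sqrtr_sqr.
have -> : Normc.normc (sigma j 0) / 2 = Normc.normc (sigma j 0 * (1 / 2)%:C).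
  by rewrite Normc.normcM nr ger0_norm ?mul1r // invr_ge0.
rewrite e normcN; apply: le_trans (le_normcD _ _) _; rewrite lerD2l.
elim/big_rec2: _ => [|k y x kj IH]; first by rewrite Normc.normc0.
by apply: le_trans (le_normcD _ _) _; rewrite lerD // Normc.normcM nr.
Qed.

(** * The function [e^(-c/(2t))] continued by zero, and its derivative *)

Section Flat.
Variable R : realType.
Implicit Types (c t : R).
Local Notation mu := (@lebesgue_measure R).

(** The linear bound squeezes the function to [0] at the origin. *)
Lemma continuous_cut (h : R -> R) (K : R) :
  (forall t, 0 < t -> {for t, continuous h}) ->
  (forall t, 0 < t -> `|h t| <= K * t) ->
  continuous (fun t => if 0 < t then h t else 0).
Proof.
move=> ch hK t; rewrite /continuous_at.
have [t0|t0|->] := ltrgt0P t.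
- apply: cvg_trans (ch _ t0); apply: near_eq_cvg.
  by near=> y; rewrite ifT //; near: y; exact: lt_nbhsr.
- have : (fun=> 0 : R) y @[y --> t] --> (0 : R) by exact: cvg_cst.
  apply: cvg_trans; apply: near_eq_cvg; near=> y; rewrite ifF //; apply/negbTE; rewrite -leNgt ltW //.
  by near: y; exact: lt_nbhsl.
- have c0 : (fun y => `|K| * `|y|) y @[y --> (0 : R)] --> `|K| * `|0 : R|.
    by apply: cvgMr; apply: cvg_norm; exact: cvg_id.
  rewrite normr0 mulr0 in c0.
  apply/cvgrPdist_le => e e0; move/cvgrPdist_le : c0 => /(_ e e0) c0.
  near=> y; rewrite ?ltxx sub0r normrN; apply: (@le_trans _ _ `|0 - `|K| * `|y| |); last by near: y.
  rewrite sub0r normrN.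
  case: ifPn => [y0|_]; last by rewrite normr0.
  rewrite normrM !normr_id [X in _ * X](gtr0_norm y0) (le_trans (hK y y0)) //.
  by rewrite ler_wpM2r ?ler_norm // ltW.
Unshelve. all: by end_near.
Qed.

(** Used with [c = 1 - cos s], when it is the exponential in [gamma]; [dheat] is its derivative in
    [t]. *)
Definition heat c t : R := expR (- (c / (2 * t))).

Definition dheat c t : R := c / (2 * t ^+ 2) * heat c t.

(** The cut is required at [t = 0], where division by zero gives [heat c 0 = 1] and not the limit
    [0]. *)
Definition flat c t : R := if 0 < t then heat c t else 0.

Definition dflat c t : R := if 0 < t then dheat c t else 0.

Lemma is_derive_heat c t : t != 0 -> is_derive t 1 (heat c) (dheat c t).
Proof.
move=> t0.
have h1 : is_derive t 1 (fun y : R => y^-1) (- t ^- 2 *: 1).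
  by apply: is_deriveV => //; exact: is_derive_id.
have h2 := is_deriveZ (- (c / 2)) h1.
have h3 := is_derive1_comp (is_derive_expR _) h2.
have <- : expR ((- (c / 2) \*: (fun y : R => y^-1)) t) * (- (c / 2) *: (- t ^- 2 *: 1)) =
    dheat c t :> R.
  rewrite /dheat mulrC /heat /GRing.scale /=; congr (_ * expR _); first by field.
  by rewrite /GRing.scale /=; field.
rewrite (_ : heat c = expR \o (- (c / 2) \*: (fun y : R => y^-1))) //.
by apply/funext => y /=; rewrite /heat /GRing.scale /= invfM mulNr mulrA.
Qed.

Lemma continuous_heat c t : t != 0 -> {for t, continuous (heat c)}.
Proof.
move=> t0; apply: differentiable_continuous; apply/derivable1_diffP.
by have [] := is_derive_heat c t0.
Qed.

Lemma continuous_dheat c t : t != 0 -> {for t, continuous (dheat c)}.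
Proof.
move=> t0; apply: cvgM; last exact: continuous_heat.
apply: cvgMr; apply: cvgV; first by rewrite mulf_neq0 ?expf_neq0.
by apply: cvgMr; exact: exprn_continuous.
Qed.

Lemma heat_le c t : 0 < c -> 0 < t -> heat c t <= 2 / c * t.
Proof.
move=> c0 t0; rewrite /heat expRN.
have y0 : 0 < c / (2 * t) by rewrite divr_gt0 ?mulr_gt0.
have -> : 2 / c * t = (c / (2 * t))^-1 by field; rewrite !gt_eqF.
rewrite lef_pV2 ?posrE ?expR_gt0 //; apply: le_trans (expR_ge1Dx _); lra.
Qed.

(** With [y = c / (2t)], the bound [e^y >= y^3 / 6] leaves
    [c / (2 t^2) * 48 t^3 / c^3 = 24 t / c^2]. *)
Lemma dheat_le c t : 0 < c -> 0 < t -> `|dheat c t| <= 24 / c ^+ 2 * t.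
Proof.
move=> c0 t0; rewrite /dheat /heat expRN.
have y0 : 0 < c / (2 * t) by rewrite divr_gt0 ?mulr_gt0.
rewrite ger0_norm; last by rewrite mulr_ge0 ?invr_ge0 ?expR_ge0 ?divr_ge0 ?mulr_ge0 ?exprn_ge0 ?ltW.
have e : (c / (2 * t)) ^+ 3 / 6 <= expR (c / (2 * t)).
  by have := expR_ge1Dxn 2 (ltW y0); rewrite (_ : 3`! = 6)%N //; lra.
rewrite -ler_pdivlMl; last by rewrite divr_gt0 ?mulr_gt0 ?exprn_gt0.
have -> : (c / (2 * t ^+ 2))^-1 * (24 / c ^+ 2 * t) = ((c / (2 * t)) ^+ 3 / 6)^-1.
  by field; rewrite !gt_eqF.
by rewrite lef_pV2 ?posrE ?expR_gt0 // divr_gt0 // exprn_gt0.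
Qed.

Lemma continuous_flat c : 0 < c -> continuous (flat c).
Proof.
move=> c0; apply: (@continuous_cut _ (2 / c)) => t t0.
  by apply: continuous_heat; rewrite gt_eqF.
by rewrite ger0_norm ?expR_ge0 // heat_le.
Qed.

Lemma continuous_dflat c : 0 < c -> continuous (dflat c).
Proof.
move=> c0; apply: (@continuous_cut _ (24 / c ^+ 2)) => t t0.
  by apply: continuous_dheat; rewrite gt_eqF.
exact: dheat_le.
Qed.

Lemma is_derive_flat c t : 0 < t -> is_derive t 1 (flat c) (dflat c t).
Proof.
move=> t0; rewrite /dflat t0; have := is_derive_heat c (lt0r_neq0 t0).
apply: near_eq_is_derive; near=> y; rewrite /flat ifT //.
by near: y; exact: lt_nbhsr.
Unshelve. all: by end_near.
Qed.

(** At [t = 0] division by zero makes [dheat] equal to [0], which is the value of [dflat] there. *)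
Lemma dheatE c t : 0 <= t -> dheat c t = dflat c t.
Proof.
rewrite le_eqVlt /dflat => /predU1P[<-|->] //.
by rewrite ltxx /dheat expr0n mulr0 invr0 mulr0 mul0r.
Qed.

(** The primitive is [- flat c (a - tau)]. When [b = a] the argument reaches [0] at the right end,
    so the derivative is taken only for [tau < b] and continuity of [flat] and [dflat] covers the
    endpoint. *)
Lemma integral_dheat c (a b : R) : 0 < c -> 0 < b -> b <= a ->
  (\int[mu]_(tau in `[0%R, b]) (dheat c (a - tau))%:E = (flat c a - flat c (a - b))%:E)%E.
Proof.
move=> c0 b0 ba.
transitivity (\int[mu]_(tau in `[0%R, b]) (dflat c (a - tau))%:E)%E.
  apply: eq_integral => tau; rewrite inE /= in_itv /= => /andP[_ tb].
  by rewrite dheatE // subr_ge0 (le_trans tb).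
have csub : continuous (fun tau : R => a - tau).
  by move=> x; apply: cvgB; [exact: cvg_cst|exact: cvg_id].
have cF : continuous (fun tau => - flat c (a - tau)).
  move=> x; apply: cvgN.
  by apply: (continuous_comp (f := fun tau => a - tau)); [exact: csub|exact: continuous_flat].
have dF (x : R) : x < b -> is_derive x 1 (fun tau => - flat c (a - tau)) (dflat c (a - x)).
  move=> xb; have ax : 0 < a - x by rewrite subr_gt0 (lt_le_trans xb).
  have h : is_derive x 1 (fun tau : R => a - tau) (-1).
    by have := @is_deriveB _ _ _ (cst a) id x 1 0 1 _ _; rewrite sub0r; apply.
  have := is_deriveN (@is_derive1_comp _ (flat c) (fun tau => a - tau) x _ _ (is_derive_flat c ax) h).
  by rewrite mulrN1 opprK.
rewrite (@continuous_FTC2 _ _ (fun tau => - flat c (a - tau))) //.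
- by rewrite subr0 -EFinB opprK addrC.
- apply: continuous_subspaceT => x.
  by apply: (continuous_comp (f := fun tau => a - tau)); [exact: csub|exact: continuous_dflat].
- split => [x||].
  + by rewrite in_itv /= => /andP[_ xb]; have [] := dF x xb.
  + exact/cvg_at_right_filter/cF.
  + exact/cvg_at_left_filter/cF.
- by move=> x; rewrite in_itv /= => /andP[_ xb]; rewrite derive1E; have [_ ->] := dF x xb.
Qed.

Lemma measurable_inv : measurable_fun [set: R] (fun t : R => t^-1).
Proof.
rewrite -(setUv [set (0 : R)]); apply/measurable_funU.
- exact: measurable_set1.
- by apply: measurableC; exact: measurable_set1.
split; first exact: measurable_fun_set1.
apply: open_continuous_measurable_fun => [|t].
  by apply: closed_openC; apply: accessible_closed_set1; apply: hausdorff_accessible; exact: norm_hausdorff.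
by rewrite inE /= => /eqP t0; exact: inv_continuous.
Qed.

End Flat.

(** * Exchange of integrals over a product of two sets *)

Section FubiniSetX.
Variable R : realType.
Local Notation mu := (@lebesgue_measure R).
Local Open Scope ereal_scope.

(** Extending [k] by zero off the product reduces the claim to the whole plane, where the finite
    iterated integral of the absolute value gives integrability. *)
Lemma Fubini_setX (A B : set R) (k : R * R -> R) :
  measurable A -> measurable B -> measurable_fun setT k ->
  \int[mu]_(x in A) \int[mu]_(y in B) `|k (x, y)|%:E < +oo ->
  \int[mu]_(x in A) \int[mu]_(y in B) (k (x, y))%:E =
  \int[mu]_(y in B) \int[mu]_(x in A) (k (x, y))%:E.
Proof.
move=> mA mB mk fin.
pose f : R * R -> \bar R := (EFin \o k) \_ (A `*` B).
have mf : measurable_fun setT f.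
  apply/(measurable_restrictT _ (measurableX mA mB)).
  exact/measurable_funTS/measurable_EFinP.
have fE x y : f (x, y) = if (x \in A) && (y \in B) then (k (x, y))%:E else 0.
  rewrite /f patchE; congr (if _ then _ else _).
  by apply/idP/andP => [/set_mem[] /mem_set ? /mem_set ?|[/set_mem ? /set_mem ?]] //; exact/mem_set.
have e1 : \int[mu]_(x in A) \int[mu]_(y in B) (k (x, y))%:E = \int[mu]_x \int[mu]_y f (x, y).
  rewrite integral_mkcond; apply: eq_integral => x _; rewrite patchE.
  case: ifPn => xA; last by rewrite integral0_eq // => y _; rewrite fE (negbTE xA).
  by rewrite integral_mkcond; apply: eq_integral => y _; rewrite fE patchE xA.
have e2 : \int[mu]_(y in B) \int[mu]_(x in A) (k (x, y))%:E = \int[mu]_y \int[mu]_x f (x, y).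
  rewrite integral_mkcond; apply: eq_integral => y _; rewrite patchE.
  case: ifPn => yB; last by rewrite integral0_eq // => x _; rewrite fE (negbTE yB) andbF.
  by rewrite integral_mkcond; apply: eq_integral => x _; rewrite fE patchE yB andbT.
rewrite e1 e2; apply: Fubini.
have [_ h] := integrable12ltyP mu mu mf; apply: h.
apply: le_lt_trans fin; rewrite le_eqVlt; apply/orP; left; apply/eqP.
rewrite [RHS]integral_mkcond; apply: eq_integral => x _; rewrite patchE.
case: ifPn => xA; last by rewrite integral0_eq // => y _; rewrite fE (negbTE xA) abse0.
rewrite [RHS]integral_mkcond; apply: eq_integral => y _; rewrite fE patchE xA /=.
by case: ifP; rewrite ?abse0.
Qed.

End FubiniSetX.

(** * The coefficients [vcoef] as increments of the primitive, their signs and their sum *)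

Section VolterraCoefficients.
Variable R : realType.
Local Notation mu := (@lebesgue_measure R).
Implicit Types (c t s : R).

Lemma integrable_dheat c (a b : R) : 0 < c -> b <= a ->
  mu.-integrable `[0, b] (EFin \o (fun tau => dheat c (a - tau))).
Proof.
move=> c0 ba.
have h : mu.-integrable `[0, b] (EFin \o (fun tau => dflat c (a - tau))).
  apply: continuous_integrable_itv => x.
  apply: (continuous_comp (f := fun tau => a - tau)); last exact: continuous_dflat.
  by apply: cvgB; [exact: cvg_cst|exact: cvg_id].
apply: eq_integrable h => // tau; rewrite inE /= in_itv /= => /andP[_ tb].
by rewrite dheatE // subr_ge0 (le_trans tb).
Qed.

Lemma dheat_ge0 c t : 0 <= c -> 0 <= dheat c t.
Proof.
by move=> c0; rewrite mulr_ge0 ?expR_ge0 // divr_ge0 // mulr_ge0 // exprn_even_ge0.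
Qed.

Lemma integral_dheatM c (a b m : R) : 0 < c -> 0 < b -> b <= a ->
  (\int[mu]_(tau in `[0%R, b]) (dheat c (a - tau) * m)%:E =
   ((flat c a - flat c (a - b)) * m)%:E)%E.
Proof.
move=> c0 b0 ba; under eq_integral => tau _ do rewrite EFinM.
by rewrite integralZr // ?integral_dheat //; exact: integrable_dheat.
Qed.

Lemma continuous_heat_cos t : continuous (fun s => heat (1 - cos s) t).
Proof.
move=> s; apply: (continuous_comp (f := fun s => - ((1 - cos s) / (2 * t))) (g := @expR R));
  last exact: continuous_expR.
apply: cvgN; apply: cvgMl; apply: cvgB; [exact: cvg_cst|exact: continuous_cos].
Qed.

Lemma continuous_flat_cos t : continuous (fun s => flat (1 - cos s) t).
Proof.
rewrite /flat; case: (0 < t); first exact: continuous_heat_cos.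
exact: cst_continuous.
Qed.

Lemma continuous_dheat_cos t : continuous (fun s => dheat (1 - cos s) t).
Proof.
move=> s; apply: cvgM; last exact: continuous_heat_cos.
by apply: cvgMl; apply: cvgB; [exact: cvg_cst|exact: continuous_cos].
Qed.

(** Cosine is injective on [[0, pi]], and points beyond [pi] are reflected to [2 pi - s]. *)
Lemma cos_lt1 s : 0 < s < 2 * pi -> cos s < 1.
Proof.
move=> /andP[s0 s2]; rewrite lt_neqAle cos_le1 andbT; apply/eqP => cs.
have p0 := pi_gt0 R.
have [sp|ps] := lerP s pi.
  have := @cos_inj R s 0; rewrite !in_itv /= cs cos0 lexx (ltW s0) sp ltW // => h.
  by move: s0; rewrite h // ltxx.
have e : cos (2 * pi - s) = 1.
  have -> : 2 * pi - s = - s + pi *+ 2 by rewrite addrC mulr_natl.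
  by rewrite cosD2pi cosN.
have h := @cos_inj R (2 * pi - s) 0; move: h; rewrite !in_itv /= e cos0 lexx.
have -> : 0 <= 2 * pi - s by lra.
have -> : 2 * pi - s <= pi by lra.
by rewrite (ltW p0) => /(_ isT isT erefl); lra.
Qed.

(** Dropping the endpoints keeps [c = 1 - cos s] positive, as the results on [flat] require. *)
Lemma circ_open (f : R -> R) : continuous f ->
  circ f = \int[mu]_(s in `]0, (2 * pi)[) f s.
Proof.
move=> cf; have ci := continuous_integrable_itv 0 (2 * pi) cf.
rewrite /circ -Rintegral_itv_obnd_cbnd; last first.
  by apply: integrableS ci => //; apply: subset_itv; rewrite bnd_simp.
rewrite -Rintegral_itv_bndo_bndc //.
by apply: integrableS ci => //; apply: subset_itv; rewrite bnd_simp.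
Qed.

Lemma integrable_open (f : R -> R) : continuous f ->
  mu.-integrable `]0, (2 * pi)[ (EFin \o f).
Proof.
move=> cf; have ci := continuous_integrable_itv 0 (2 * pi) cf.
by apply: integrableS ci => //; apply: subset_itv; rewrite bnd_simp.
Qed.

Section Mode.
Variable n : nat.

Definition mode s : R := cos (n%:R * s) / (4 * pi).

Lemma continuous_mode : continuous mode.
Proof. by move=> s; apply: cvgMl; exact: continuous_cosM. Qed.

Lemma continuousM_mode (f : R -> R) : continuous f -> continuous (fun s => f s * mode s).
Proof. by move=> cf s; apply: cvgM; [exact: cf|exact: continuous_mode]. Qed.

(* [pot] extended by its limit [0] at [t = 0]; [pot 0] itself is computed with
   division by zero. *)
Definition pot0 t : R := circ (fun s => flat (1 - cos s) t * mode s).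

Lemma pot0_eq0 t : t <= 0 -> pot0 t = 0.
Proof.
rewrite leNgt /pot0 /flat => /negbTE ->.
rewrite (_ : (fun s => _) = (fun=> 0)) ?circ_cst ?mulr0 //.
by apply/funext => s; rewrite mul0r.
Qed.

Lemma pot0E t : 0 < t -> pot0 t = pot n t.
Proof.
move=> t0; rewrite /pot0 /pot /flat t0 -circZ.
  by congr circ; apply/funext => s; rewrite /heat /mode; move: (expR _) => E; ring.
by move=> s; apply: cvgM; [exact: continuous_heat_cos|exact: continuous_cosM].
Qed.

Lemma pot0_bounds t : 0 <= pot0 t <= 1 / (2 * (2 * n%:R + 1)).
Proof.
have [t0|t0] := lerP t 0.
  by rewrite pot0_eq0 // lexx divr_ge0 // mulr_ge0 // addr_ge0 // mulr_ge0.
by rewrite pot0E // pot_ge0 // pot_le.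
Qed.

(** The denominators vanish at [tau = a], so joint measurability is assembled factor by factor
    through [measurable_inv]. *)
Lemma measurable_dheat_mode (a : R) :
  measurable_fun setT (fun p : R * R => dheat (1 - cos p.1) (a - p.2) * mode p.1).
Proof.
have ccos : continuous (fun s : R => 1 - cos s).
  by move=> s; apply: cvgB; [exact: cvg_cst|exact: continuous_cos].
have csub : continuous (fun t : R => a - t).
  by move=> s; apply: cvgB; [exact: cvg_cst|exact: cvg_id].
have mc : measurable_fun setT (fun p : R * R => 1 - cos p.1).
  exact: (measurableT_comp (continuous_measurable_fun ccos) measurable_fst).
have mi (g : R -> R) : continuous g -> measurable_fun setT (fun p : R * R => (g p.2)^-1).
  move=> cg; apply: (measurableT_comp (@measurable_inv R)).
  exact: (measurableT_comp (continuous_measurable_fun cg) measurable_snd).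
apply: measurable_funM; last first.
  exact: (measurableT_comp (continuous_measurable_fun continuous_mode) measurable_fst).
apply: measurable_funM.
  apply: measurable_funM => //; apply: (mi (fun t => 2 * (a - t) ^+ 2)) => t.
  apply: cvgMr; apply: (continuous_comp (f := fun t => a - t) (g := fun y => y ^+ 2)).
    exact: csub.
  exact: exprn_continuous.
apply: (measurableT_comp (@measurable_expR R)); apply: measurableT_comp.
  by apply: continuous_measurable_fun; exact: opp_continuous.
apply: measurable_funM => //; apply: (mi (fun t => 2 * (a - t))) => t.
by apply: cvgMr; exact: csub.
Qed.

End Mode.

Lemma gamma_mode (n : int) t :
  gamma n t = \int[mu]_(s in `]0, (2 * pi)[) (dheat (1 - cos s) t * mode `|n| s).
Proof.
have cd := continuous_dheat_cos (t := t).
rewrite -circ_open; last exact: continuousM_mode.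
rewrite /gamma -/(circ _) -circZ; last first.
  move=> s; apply: cvgM; last exact: continuous_cosM.
  apply: cvgM; last exact: continuous_heat_cos.
  by apply: cvgB; [exact: cvg_cst|exact: continuous_cos].
congr circ; apply/funext => s; rewrite cos_intM /dheat /mode /heat.
move: (cos s) (cos (`|n|%N%:R * s)) (expR _) => c1 c2 h.
by rewrite div1r -mulrA (_ : 8 * (pi * t ^+ 2) = (2 * t ^+ 2) * (4 * pi)) ?invfM; ring.
Qed.

(** After exchanging the integrals, the inner one over [tau] is, for each [s], an increment of
    [flat] between [l dt] and [(l+1) dt]. For [l = 0] the lower end is [0], whence [pot0]. *)
Lemma vcoef_pot (n : int) (dt : R) (l : nat) : 0 < dt ->
  vcoef n dt l.+1 = pot0 `|n| (l.+1%:R * dt) - pot0 `|n| (l%:R * dt).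
Proof.
move=> dt0; set a := l.+1%:R * dt.
have a_dt : a - dt = l%:R * dt by rewrite /a -addn1 natrD mulrDl mul1r addrK.
have dta : dt <= a by rewrite -subr_ge0 a_dt mulr_ge0 // ltW.
have c0 (s : R) : s \in (`]0, (2 * pi)[ : set R) -> 0 < 1 - cos s.
  by rewrite inE /= in_itv /= => ss; rewrite subr_gt0 cos_lt1.
pose D s := flat (1 - cos s) a - flat (1 - cos s) (a - dt).
have cD : continuous D by move=> s; apply: cvgB; exact: continuous_flat_cos.
pose k (p : R * R) := dheat (1 - cos p.1) (a - p.2) * mode `|n| p.1.
have gE t : (gamma n t)%:E =
    (\int[mu]_(s in `]0%R, (2 * pi)%R[) (dheat (1 - cos s) t * mode `|n| s)%:E)%E.
  rewrite gamma_mode /Rintegral fineK //; apply: integrable_fin_num => //.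
  by apply: integrable_open; apply: continuousM_mode; exact: continuous_dheat_cos.
rewrite /vcoef /Rintegral; under eq_integral => tau _ do rewrite gE.
rewrite -(@Fubini_setX R `]0, (2 * pi)[ `[0, dt] k) //; last 2 first.
- exact: measurable_dheat_mode.
(* As [dheat] is nonnegative, the absolute value falls on [mode] alone; the inner integral is
   [D s * |mode s|], continuous in [s], so the iterated integral is finite. *)
- have cDm : continuous (fun s => D s * `|mode `|n| s|).
    move=> s; apply: cvgM; first exact: cD.
    by apply: cvg_norm; exact: continuous_mode.
  rewrite (@eq_integral _ _ R mu _ (fun s => (D s * `|mode `|n| s|)%:E)) => [|s /c0 cs].
    have := integrable_fin_num _ (integrable_open cDm).
    by move=> /(_ (measurable_itv _)); rewrite fin_numElt => /andP[].
  rewrite -integral_dheatM //; apply: eq_integral => tau _.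
  by rewrite /k /= normrM ger0_norm // dheat_ge0 // ltW.
rewrite (@eq_integral _ _ R mu _ (fun s => (D s * mode `|n| s)%:E)); last first.
  by move=> s /c0 cs; rewrite -integral_dheatM.
rewrite -a_dt /pot0 !circ_open; try by apply: continuousM_mode; exact: continuous_flat_cos.
rewrite -RintegralB //; try by apply: integrable_open; apply: continuousM_mode; exact: continuous_flat_cos.
by congr fine; apply: eq_integral => s _; rewrite /D mulrBl.
Qed.

(** A negative coefficient forces [gamma n t < 0] for some [t <= (l+1) dt]. The times entering the
    later coefficient are at least [l' dt], hence lie after [t]. *)
Lemma vcoef_sign (n : int) (dt : R) (l l' : nat) : 0 < dt -> (l < l')%N ->
  vcoef n dt l.+1 < 0 -> vcoef n dt l'.+1 <= 0.
Proof.
move=> dt0 ll' v0.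
have [t [tl tpos tneg]] : exists t, [/\ t <= l.+1%:R * dt, 0 < t & gamma n t < 0].
  apply: contrapT => h; move: v0; apply/negP; rewrite -leNgt.
  apply: Rintegral_ge0 => tau; rewrite /= in_itv /= => /andP[tau0 taudt].
  have t0 : 0 <= l.+1%:R * dt - tau.
    by rewrite subr_ge0 (le_trans taudt) // ler_peMl ?ler1n // ltW.
  (* At time [0], reached when [l = 0] and [tau = dt], [gamma] evaluates to [0] by division by zero,
     so a negative value occurs at a positive time. *)
  move: t0; rewrite le_eqVlt => /predU1P[<-|t0].
    by rewrite /gamma expr0n mulr0 invr0 mulr0 mul0r.
  rewrite leNgt; apply/negP => g0; apply: h; exists (l.+1%:R * dt - tau); split => //.
  by rewrite gerBl.
have le0 tau : tau \in (`[0, dt] : set R) -> gamma n (l'.+1%:R * dt - tau) <= 0.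
  rewrite inE /= in_itv /= => /andP[tau0 taudt].
  apply: gamma_le0_after tpos _ tneg; apply: (le_trans tl).
  apply: (@le_trans _ _ (l'.+1%:R * dt - dt)); last by rewrite lerD2l lerN2.
  by rewrite -[l'.+1]addn1 natrD mulrDl mul1r addrK ler_wpM2r ?ler_nat // ltW.
rewrite /vcoef /Rintegral fine_le0 // -oppe_ge0.
under eq_integral => tau _ do rewrite -[gamma _ _]opprK EFinN.
rewrite integral_ge0N => [|tau tt]; last by rewrite lee_fin oppr_ge0 le0 // inE.
rewrite oppeK; apply: integral_ge0 => tau tt.
by rewrite lee_fin oppr_ge0 le0 // inE.
Qed.

(** The partial sums telescope to [pot0] at [L dt], as [pot0] vanishes at [0]; twice the bound of
    [pot0_bounds] is the right-hand side. *)
Lemma sum_norm_vcoef_le (n : int) (dt : R) (N : nat) : 0 < dt ->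
  \sum_(0 <= l < N) `|vcoef n dt l.+1| <= 1 / (2 * `|n|%:~R + 1).
Proof.
move=> dt0.
have nE : `|n|%:~R = `|n|%N%:R :> R by rewrite -abszE -pmulrn.
have sE L : \sum_(0 <= l < L) vcoef n dt l.+1 = pot0 `|n| (L%:R * dt).
  under eq_bigr => l _ do rewrite vcoef_pot //.
  by rewrite (telescope_sumr (fun l => pot0 `|n| (l%:R * dt))) // mul0r [pot0 _ 0]pot0_eq0 // subr0.
have n0 : 2 * `|n|%N%:R + 1 != 0 :> R by rewrite gt_eqF // ltr_wpDl // mulr_ge0.
have -> : 1 / (2 * `|n|%:~R + 1) = 2 * (1 / (2 * (2 * `|n|%N%:R + 1))) :> R.
  by rewrite nE; field.
apply: sum_norm_le_unimodal => [L|l l']; first by rewrite sE pot0_bounds.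
exact: vcoef_sign.
Qed.

End VolterraCoefficients.

(** * The [l2] estimate for nonzero modes *)

Theorem corollary1 (R : realType) (N : nat) (dt : R) (n : int)
    (sigma f : 'cV[R[i]]_N.+1) :
  (1 <= N)%N -> 0 < dt -> n != 0 ->
  f ord0 0 = 0 -> sigma ord0 0 = 0 ->
  map_mx (real_complex R) (- (1 / 2)%:M - Vmx n dt N) *m sigma = f ->
  l2norm sigma <= 1 / (1 / 2 - 1 / (2 * `|n|%:~R + 1)) * l2norm f /\
  1 / (1 / 2 - 1 / (2 * `|n|%:~R + 1)) * l2norm f <= 6 * l2norm f.
Proof.
move=> _ dt0 n0 _ _ eqf.
have n1 : 1 <= `|n|%:~R :> R by rewrite -[1]/(1%:~R) ler_int -gtz0_ge1 normr_gt0.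
(* From [|n| >= 1] the sum is at most [1/3 < 1/2], and [1/2 - 1/3 = 1/6] yields the constant [6]. *)
have A3 : 1 / (2 * `|n|%:~R + 1) <= 1 / 3 :> R.
  by rewrite ler_pM2l // lef_pV2 ?posrE; lra.
split; first by apply: euler_stable eqf (sum_norm_vcoef_le _ _ dt0) _; lra.
rewrite ler_wpM2r ?sqrtr_ge0 // ler_pdivrMr; lra.
Qed.
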